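(* Let $A=(a_{i,j})$ and $B=(b_{i,j})$ be $n\times n$ matrices with entries in $\{0,1\}$. If one of the matrices $A$ or $B$ is a permutation matrix, then $O_{A,B}$ is ($*$-isomorphic to) a Cuntz-Krieger algebra. More precisely, if $B$ is a permutation matrix then $O_{A,B}$ is $*$-isomorphic to the Cuntz-Krieger algebra $O_{\widetilde{A}}$, where $\widetilde{A}=B^tA$.
   Context: For an $n\times n$ matrix $D=(d_{i,j})$ with entries in $\{0,1\}$, the Cuntz-Krieger algebra $O_D$ is the universal C*-algebra generated by $n$ partial isometries $S_1,\dots,S_n$ with the relations $\sum_{i=1}^nS_iS_i^*=1$ and $S_i^*S_i=\sum_{j:\,d_{i,j}=1}S_jS_j^*$ for each $i$. Let $\mathbb{F}_n$ be the free group with generators $1,2,\dots,n$ (the generators are denoted by these symbols), neutral element $e$, and let $|r|$ denote the length of the reduced form of $r\in\mathbb{F}_n$. The algebra $O_{A,B}$ is the partial group C*-algebra with projections and relations generated by $\mathbb{F}_n$ and projections $P_1,\dots,P_n$; that is, the universal C*-algebra generated by $\{[r]:r\in\mathbb{F}_n\}$ and $P_1,\dots,P_n$ subject to the following relations. First, the relations of a partial group algebra with projections, for all $r,s\in\mathbb{F}_n$ and $i,j\in\{1,\dots,n\}$: $[e]=1$; $[r^{-1}]=[r]^*$; $[r][s][s^{-1}]=[rs][s^{-1}]$; $P_i^*=P_i=P_i^2$; $[r][r]^*$ and $[s]P_j[s]^*$ commute; $[r]P_i[r]^*$ and $[s]P_j[s]^*$ commute. Second, the relations: $\sum_{i=1}^nP_i=1$;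 $[i]^*[i]=\sum_{j=1}^na_{i,j}P_j$ for each $i\in\{1,\dots,n\}$; $[i][i]^*=\sum_{j=1}^nb_{i,j}P_j$ for each $i\in\{1,\dots,n\}$; and $[r][r]^*[rs][rs]^*=[rs][rs]^*$ for all $r,s\in\mathbb{F}_n$ with $|rs|=|r|+|s|$. *)

(* Defs.v *)
From HB Require Import structures.
From mathcomp Require Import all_boot all_order all_algebra.
From mathcomp Require Import all_classical all_reals all_analysis.
From mathcomp Require Import complex.

Set Implicit Arguments.
Unset Strict Implicit.
Unset Printing Implicit Defensive.

Import Order.TTheory GRing.Theory Num.Theory.
Import numFieldNormedType.Exports.

Local Open Scope ring_scope.

(* Unital C*-algebras over C = R[i]. The zero algebra is allowed (the algebra *)
(* laws yield a [pzRingType], not a [nzRingType] or [algType]), since the     *)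
(* relations may force 1 = 0, as the Cuntz-Krieger relations of a nilpotent   *)
(* matrix do. The product is a field of the mixin, and the ring structure is  *)
(* derived from it below, because Hierarchy Builder has no join of the        *)
(* classes PzRing and NormedModule.                                           *)
HB.mixin Record isCStarAlgebra (R : realType) A
    of CompleteNormedModule R[i] A := {
  cone : A;
  cmul : A -> A -> A;
  cmulA : associative cmul;
  cmul1r : left_id cone cmul;
  cmulr1 : right_id cone cmul;
  cmulDl : left_distributive cmul +%R;
  cmulDr : right_distributive cmul +%R;
  cscaleAl : forall (a : R[i]) (x y : A), a *: cmul x y = cmul (a *: x) y;
  cscaleAr : forall (a : R[i]) (x y : A), a *: cmul x y = cmul x (a *: y);
  star : A -> A;
  starK : involutive star;
  starD : {morph star : x y / x + y};
  starZ : forall (a : R[i]) (x : A), star (a *: x) = a^* *: star x;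
  starM : forall x y : A, star (cmul x y) = cmul (star y) (star x);
  cnormM : forall x y : A, `|cmul x y| <= `|x| * `|y|;
  cstar_norm : forall x : A, `|cmul (star x) x| = `|x| ^+ 2
}.

#[short(type="cstarAlgType")]
HB.structure Definition CStarAlgebra (R : realType) :=
  { A of CompleteNormedModule R[i] A & isCStarAlgebra R A }.

HB.instance Definition _ (R : realType) (X : cstarAlgType R) :=
  GRing.Zmodule_isPzRing.Build (CStarAlgebra.sort X)
    (@cmulA R X) (@cmul1r R X) (@cmulr1 R X) (@cmulDl R X) (@cmulDr R X).

Section StarHom.
Variable R : realType.

(* Unital *-homomorphisms (automatically contractive). *)
Record star_hom (X Y : cstarAlgType R) (f : X -> Y) : Prop := StarHom {
  star_homD : {morph f : x y / x + y};
  star_homZ : forall (a : R[i]) (x : X), f (a *: x) = a *: f x;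
  star_hom1 : f 1 = 1;
  star_homM : {morph f : x y / x * y};
  star_homS : {morph f : x / star x}
}.

Definition star_isomorphic (X Y : cstarAlgType R) : Prop :=
  exists f : X -> Y, star_hom f /\ bijective f.

(* [X], with generators [g : G -> X], is the universal unital C*-algebra on   *)
(* [G] subject to the relations [rel].                                        *)
Definition universal_cstar (G : Type)
    (rel : forall X : cstarAlgType R, (G -> X) -> Prop)
    (X : cstarAlgType R) (g : G -> X) : Prop :=
  rel X g /\
  forall (Y : cstarAlgType R) (h : G -> Y), rel Y h ->
    exists! f : X -> Y, star_hom f /\ forall x : G, f (g x) = h x.

Lemma star_hom_id (X : cstarAlgType R) : star_hom (@id X).
Proof. by split. Qed.

Lemma star_hom_comp (X Y Z : cstarAlgType R) (f : X -> Y) (g : Y -> Z) :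
  star_hom f -> star_hom g -> star_hom (g \o f).
Proof.
move=> [fD fZ f1 fM fS] [gD gZ g1 gM gS]; split=> [x y|a x||x y|x] /=.
- by rewrite fD gD.
- by rewrite fZ gZ.
- by rewrite f1 g1.
- by rewrite fM gM.
- by rewrite fS gS.
Qed.

Lemma universal_cstar_iso (G : Type)
    (rel : forall X : cstarAlgType R, (G -> X) -> Prop)
    (X Y : cstarAlgType R) (g : G -> X) (h : G -> Y) :
  universal_cstar rel g -> universal_cstar rel h -> star_isomorphic X Y.
Proof.
have endo (Z : cstarAlgType R) (k : G -> Z) (f : Z -> Z) :
    universal_cstar rel k -> star_hom f -> (forall x, f (k x) = k x) -> f =1 id.
  move=> [rk uk] hf fE z; have [e [_ eU]] := uk _ _ rk.
  have [ef ei] := (eU f (conj hf fE), eU id (conj (star_hom_id Z) (fun=> erefl))).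
  by rewrite -ef ei.
move=> uX uY.
have [f [[hf fE] _]] := uX.2 _ _ uY.1.
have [f' [[hf' fE'] _]] := uY.2 _ _ uX.1.
exists f; split=> //; exists f' => z.
- apply: (endo _ g (f' \o f)) => // [|x]; first exact: star_hom_comp.
  by rewrite /= fE fE'.
- apply: (endo _ h (f \o f')) => // [|x]; first exact: star_hom_comp.
  by rewrite /= fE' fE.
Qed.

End StarHom.

(* The free group on 'I_n: reduced words in the letters (i, b), where         *)
(* (i, false) stands for the generator i and (i, true) for its inverse.       *)
Section FreeGroup.
Variable n : nat.
Implicit Types (l : 'I_n * bool) (u v w : seq ('I_n * bool)).

Definition linv l := (l.1, ~~ l.2).

Definition reduced w := sorted (fun k l => l != linv k) w.

Definition push l w :=
  if w is k :: w' then if k == linv l then w' else l :: w else [:: l].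

Definition wmul u v := foldr push v u.
Definition winv w := rev (map linv w).

Lemma linvK : involutive linv.
Proof. by move=> [i b]; rewrite /linv /= negbK. Qed.

Lemma push_reduced l w : reduced w -> reduced (push l w).
Proof.
case: w => //= k w red; case: eqVneq => [_|nkl]; first exact: path_sorted red.
by rewrite /reduced /= nkl.
Qed.

Lemma wmul_reduced u v : reduced v -> reduced (wmul u v).
Proof. by move=> rv; elim: u => //= l u; apply: push_reduced. Qed.

Lemma push_cons l w : reduced (l :: w) -> push l w = l :: w.
Proof. by case: w => //= k w /andP[/negbTE->]. Qed.

Lemma pushK l w : reduced w -> push l (push (linv l) w) = w.
Proof.
case: w => [_|k w] /=; first by rewrite eqxx.
rewrite linvK; case: eqVneq => [->|_ _] /=; last by rewrite eqxx.
exact: push_cons.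
Qed.

Lemma wmul_push l u v : reduced v -> wmul (push l u) v = push l (wmul u v).
Proof.
move=> rv; case: u => //= k u; case: eqP => [->|//] /=.
by rewrite pushK //; apply: wmul_reduced.
Qed.

Lemma wmulA u v w : reduced w -> wmul u (wmul v w) = wmul (wmul u v) w.
Proof. by move=> rw; elim: u => //= l u ->; rewrite wmul_push. Qed.

Lemma wmulw1 u : reduced u -> wmul u [::] = u.
Proof.
elim: u => //= l u IHu red; rewrite IHu ?push_cons //.
exact: path_sorted red.
Qed.

Lemma winv_reduced w : reduced w -> reduced (winv w).
Proof.
rewrite /reduced /winv rev_sorted sorted_map; apply: sub_sorted => k l /=.
by apply: contra => /eqP->; rewrite linvK.
Qed.

Lemma wmulVw w : wmul (winv w) w = [::].
Proof.
elim: w => //= l w IHw.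
by rewrite /winv /= rev_cons /wmul foldr_rcons /= linvK eqxx.
Qed.

Lemma winvK : involutive winv.
Proof. by move=> w; rewrite /winv map_rev revK mapK //; apply: linvK. Qed.

Definition free_group := {w : seq ('I_n * bool) | reduced w}.
HB.instance Definition _ := Choice.on free_group.

Implicit Types r s t : free_group.

Definition fg_one : free_group := exist _ [::] isT.
Definition fg_mul r s : free_group :=
  exist _ (wmul (val r) (val s)) (wmul_reduced (val r) (valP s)).
Definition fg_inv r : free_group :=
  exist _ (winv (val r)) (winv_reduced (valP r)).
Definition fg_gen (i : 'I_n) : free_group := exist _ [:: (i, false)] isT.
Definition fg_length r : nat := size (val r).

Lemma fg_mulA : associative fg_mul.
Proof. by move=> r s t; apply/val_inj/wmulA/valP. Qed.
Lemma fg_mul1g : left_id fg_one fg_mul.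
Proof. by move=> r; apply/val_inj. Qed.
Lemma fg_mulg1 : right_id fg_one fg_mul.
Proof. by move=> r; apply/val_inj/wmulw1/valP. Qed.
Lemma fg_mulVg : left_inverse fg_one fg_inv fg_mul.
Proof. by move=> r; apply/val_inj/wmulVw. Qed.
Lemma fg_mulgV : right_inverse fg_one fg_inv fg_mul.
Proof.
by move=> r; apply/val_inj => /=; rewrite -[X in wmul X _]winvK wmulVw.
Qed.

HB.instance Definition _ := isGroup.Build free_group
  fg_mulA fg_mul1g fg_mulg1 fg_mulVg fg_mulgV.

End FreeGroup.

Section Algebras.
Variable R : realType.

Definition zero_one n (A : 'M[nat]_n) : Prop :=
  forall i j, A i j = 0%N \/ A i j = 1%N.

Record cuntz_krieger_relations n (D : 'M[nat]_n)
    (X : cstarAlgType R) (S : 'I_n -> X) : Prop := CuntzKriegerRelations {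
  ck_pisom : forall i, S i * star (S i) * S i = S i;
  ck_sum : \sum_i S i * star (S i) = 1;
  ck_init : forall i,
    star (S i) * S i = \sum_(j | D i j == 1%N) S j * star (S j)
}.

Definition is_cuntz_krieger n (D : 'M[nat]_n) (X : cstarAlgType R) : Prop :=
  zero_one D /\
  exists S : 'I_n -> X, universal_cstar (cuntz_krieger_relations D) S.

Record oab_relations n (A B : 'M[nat]_n) (X : cstarAlgType R)
    (u : free_group n -> X) (P : 'I_n -> X) : Prop := OABRelations {
  oab_one : u 1%g = 1;
  oab_inv : forall r, u r^-1%g = star (u r);
  oab_mul : forall r s, u r * u s * u s^-1%g = u (r * s)%g * u s^-1%g;
  oab_proj_adj : forall i, star (P i) = P i;
  oab_proj_idem : forall i, P i * P i = P i;
  oab_comm_uP : forall r s j,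
    GRing.comm (u r * star (u r)) (u s * P j * star (u s));
  oab_comm_PP : forall r s i j,
    GRing.comm (u r * P i * star (u r)) (u s * P j * star (u s));
  oab_sum : \sum_i P i = 1;
  oab_init : forall i,
    star (u (fg_gen i)) * u (fg_gen i) = \sum_j P j *+ A i j;
  oab_final : forall i,
    u (fg_gen i) * star (u (fg_gen i)) = \sum_j P j *+ B i j;
  oab_saturated : forall r s,
    fg_length (r * s)%g = (fg_length r + fg_length s)%N ->
    (u r * star (u r)) * (u (r * s)%g * star (u (r * s)%g)) =
    u (r * s)%g * star (u (r * s)%g)
}.

(* The generators are indexed by F_n + {1, ..., n}. *)
Definition is_oab n (A B : 'M[nat]_n) (X : cstarAlgType R) : Prop :=
  exists g : free_group n + 'I_n -> X,
    universal_cstar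
      (fun (Y : cstarAlgType R) (h : free_group n + 'I_n -> Y) =>
         oab_relations A B (fun r => h (inl r)) (fun j => h (inr j))) g.

End Algebras.

(* Main.v *)
Require Import Defs.
From mathcomp Require Import all_boot all_order all_algebra.
From mathcomp Require Import all_classical all_reals all_analysis.
From mathcomp Require Import fingroup perm complex.

Set Implicit Arguments.
Unset Strict Implicit.
Unset Printing Implicit Defensive.

Import Order.TTheory GRing.Theory Num.Theory.
Import numFieldNormedType.Exports.

Local Open Scope ring_scope.

(** Let B be the matrix of a permutation sg. The relations of O_{A,B} then
say [i][i]^* = P_{sg i}, so the partial isometries S_{sg i} = [i] form a
Cuntz-Krieger family for B^t A, and they generate everything: P_j is
S_j S_j^*, and for a reduced word r the relation
[r][r]^*[rs][rs]^* = [rs][rs]^* makes [r] the product of its letters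
([oab_word]). Conversely, a Cuntz-Krieger family S for B^t A in any C*-algebra
yields elements satisfying the relations of O_{A,B}: let P_j = S_j S_j^*, and
let [r] be the product of the letters of r ([ck_oab]). Families satisfying the
two presentations therefore determine each other inside every C*-algebra, so
O_{A,B} itself has the universal property of the Cuntz-Krieger algebra of
B^t A ([oab_cuntz_krieger]), and universal objects are unique. If A is the
permutation matrix instead, the automorphism of the free group that inverts
every generator identifies O_{A,B} with O_{B,A} ([is_oab_flip]).

The verification in [ck_oab] rests on the commutation of all range projections
of words, reduced or not ([diagonal_word], [diagonal_comm]): each of them is a
sum of projections S_mu S_mu^* with mu a positive word, and any two of those
commute. With this commutation the multiplication rule of a partial
representation follows letter by letter ([range_mul_word]).

The one point where the C*-norm enters is that projections with sum 1 are
mutually orthogonal ([sum_projections_orthogonal]). Compressing the sum to the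
corner of one projection e gives self-adjoint elements c_i with sum 0 and
|e - c_i| <= 1, and the claim becomes that e is an extreme point of the unit
ball of its corner: |e + a| <= 1 and |e - a| <= 1 force a = 0. Instead of
spectral theory, the proof shows that these two bounds persist when a is
replaced by (3/2) a ([norm_stretch]); iterating, a = 0
([norm_corner_eq0]). *)

(** * Projections with sum 1 are orthogonal *)

Lemma three_halves_quadruple (F : numFieldType) : 3 / 2 *+ 4 = 6 :> F.
Proof.
by rewrite -mulr_natr -[4]/((2 * 2)%:R) natrM mulrA divfK ?pnatr_eq0 // -natrM.
Qed.

Section CStarNorm.
Variables (R : realType) (X : cstarAlgType R).
Implicit Types (x y a e p : X).

Lemma scaleMl (c : R[i]) x y : c *: (x * y) = (c *: x) * y.
Proof. exact: cscaleAl. Qed.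
Lemma scaleMr (c : R[i]) x y : c *: (x * y) = x * (c *: y).
Proof. exact: cscaleAr. Qed.
Lemma starMr x y : star (x * y) = star y * star x. Proof. exact: starM. Qed.
Lemma normM_le x y : `|x * y| <= `|x| * `|y|. Proof. exact: cnormM. Qed.
Lemma normSM x : `|star x * x| = `|x| ^+ 2. Proof. exact: cstar_norm. Qed.
Lemma star1 : star (1 : X) = 1.
Proof.
by have := starMr (star 1) (1 : X); rewrite mulr1 !starK mulr1 => <-.
Qed.
Lemma star0 : star (0 : X) = 0.
Proof. by apply: (@addrI _ (star 0)); rewrite -starD !addr0. Qed.
Lemma starN x : star (- x) = - star x.
Proof. by apply: (@addrI _ (star x)); rewrite -starD !subrr star0. Qed.
Lemma star_mul_eq0 x : star x * x = 0 -> x = 0.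
Proof.
move=> h; apply/eqP; rewrite -normr_eq0 -sqrf_eq0.
by rewrite -normSM h normr0.
Qed.

Lemma projection_norm p : star p = p -> p * p = p -> `|p| <= 1.
Proof.
move=> ps pp; have := normSM p; rewrite ps pp expr2 => h.
have [->|np] := eqVneq `|p| 0; first exact: ler01.
by rewrite -(mulfI np (etrans (mulr1 _) h)).
Qed.

Lemma norm_mid x y : `|x + y| <= 1 -> `|x - y| <= 1 -> `|x| <= 1.
Proof.
move=> hp hm; rewrite -(@ler_pMn2r _ 2) // -normrMn.
have -> : x *+ 2 = (x + y) + (x - y) by rewrite addrACA subrr addr0.
by rewrite (le_trans (ler_normD _ _)) // -[1 *+ 2]/(1 + 1) lerD.
Qed.

Lemma norm_mul_le1 x y : `|x| <= 1 -> `|y| <= 1 -> `|x * y| <= 1.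
Proof.
by move=> hx hy; rewrite (le_trans (normM_le _ _)) // mulr_ile1.
Qed.

(** Both x^2 + y^2 = ((x + y)^2 + (x - y)^2) / 2 and
x^2 - y^2 = (x + y) (x - y) are bounded by products of the given factors. *)
Lemma norm_sqr_comm x y : GRing.comm x y -> `|x + y| <= 1 -> `|x - y| <= 1 ->
  `|x * x + y * y| <= 1 /\ `|x * x - y * y| <= 1.
Proof.
move=> xy hp hm; split.
  apply: (@norm_mid _ (x * y *+ 2)).
    have -> : x * x + y * y + x * y *+ 2 = (x + y) * (x + y).
      by rewrite mulrDl !mulrDr -xy mulr2n addrACA [x * y + y * y]addrC.
    exact: norm_mul_le1.
  have -> : x * x + y * y - x * y *+ 2 = (x - y) * (x - y).
    rewrite mulrDl !mulrDr !(mulrN, mulNr) opprK -xy mulr2n opprD addrACA.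
    by rewrite [- (x * y) + y * y]addrC.
  exact: norm_mul_le1.
have -> : x * x - y * y = (x + y) * (x - y).
  by rewrite mulrDl !mulrDr !mulrN -xy addrA addrNK.
exact: norm_mul_le1.
Qed.

Section Corner.
Variable e : X.
Hypotheses (e_star : star e = e) (e_idem : e * e = e).

(** The midpoint of (e + x)^4 and (e - x)^4 is e + 6 x^2 + x^4; averaging it
with e - x^4, which is also a contraction, removes the fourth power and leaves
e + 3 x^2. *)
Lemma norm_sqr_triple x : e * x = x -> x * e = x ->
  `|e + x| <= 1 -> `|e - x| <= 1 ->
  `|e + x * x *+ 3| <= 1.
Proof.
move=> ex xe hp hm; set y := x * x.
have ey : e * y = y by rewrite /y mulrA ex.
have ye : y * e = y by rewrite /y -mulrA xe.
have [] := norm_sqr_comm (etrans ex (esym xe)) hp hm.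
rewrite e_idem -/y => yp ym.
have [_] := norm_sqr_comm (etrans ey (esym ye)) yp ym.
rewrite e_idem => zm.
(* With w = e + y and t = 2 x, the squares (e + x)^2 and (e - x)^2 are w + t
   and w - t. *)
have sqp : `|(e + y) + x *+ 2| <= 1.
  have -> : (e + y) + x *+ 2 = (e + x) * (e + x).
    by rewrite mulrDl !mulrDr e_idem ex xe addrACA [x + y]addrC.
  exact: norm_mul_le1.
have sqm : `|(e + y) - x *+ 2| <= 1.
  have -> : (e + y) - x *+ 2 = (e - x) * (e - x).
    rewrite mulrDl !mulrDr !(mulrN, mulNr) opprK e_idem ex xe.
    by rewrite mulr2n opprD addrACA [- x + y]addrC.
  exact: norm_mul_le1.
have cyx : GRing.comm (e + y) (x *+ 2).
  apply/commrMn; rewrite /GRing.comm mulrDl mulrDr ex xe /y.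
  by rewrite mulrA.
have [+ _] := norm_sqr_comm cyx sqp sqm.
have -> : (e + y) * (e + y) + x *+ 2 * (x *+ 2)
          = (e + y *+ 3) + (y *+ 3 + y * y).
  rewrite mulrnAr mulrnAl -mulrnA -/y mulrDl !mulrDr e_idem ey ye.
  rewrite -!addrA; congr (_ + _).
  by rewrite [y * y + _]addrC -[(2 * 2)%N]/4%N !mulrS mulr0n addr0 -!addrA.
move=> sq6; apply: norm_mid sq6 _.
by rewrite opprD addrA addrK.
Qed.

(** The C*-identity gives |e + ia|^2 = |e + a^2| <= 1 and the same for e - ia,
so [norm_sqr_triple] applies to ia and yields |e - 3 a^2| <= 1. Then
e + (3/2) a = (3/4) (e + a)^2 + (1/4) (e - 3 a^2) is an average of
contractions in which the squares cancel. *)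
Lemma norm_stretch a : star a = a -> e * a = a -> a * e = a ->
  `|e + a| <= 1 -> `|e - a| <= 1 ->
  `|e + 3%:R / 2%:R *: a| <= 1.
Proof.
move=> sa ea ae hp hm.
have [] := norm_sqr_comm (etrans ea (esym ae)) hp hm.
rewrite e_idem => sqp _.
pose x := 'i *: a.
have ex : e * x = x by rewrite -scaleMr ea.
have xe : x * e = x by rewrite -scaleMl ae.
have sx : star x = - x by rewrite starZ sa conjCi scaleNr.
have xx : x * x = - (a * a).
  by rewrite -scaleMl -scaleMr scalerA -expr2 sqrCi scaleN1r.
have nx y : y = x \/ y = - x -> `|e + y| <= 1.
  move=> hy; rewrite -(@expr_le1 _ 2) // -normSM starD e_star.
  have -> : (e + star y) * (e + y) = e + a * a.
    have [-> ->] : star y = - y /\ a * a = - (y * y).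
      by case: hy => ->; rewrite ?starN sx ?mulrNN xx !opprK.
    have [ey ye] : e * y = y /\ y * e = y.
      by case: hy => ->; rewrite ?mulrN ?mulNr ex xe.
    by rewrite mulrDl !mulrDr !mulNr e_idem ey ye addrA addrK.
  by [].
have := norm_sqr_triple ex xe (nx _ (or_introl erefl)) (nx _ (or_intror erefl)).
rewrite xx => sq3.
have sq2 : `|(e + a * a) + a *+ 2| <= 1.
  have -> : (e + a * a) + a *+ 2 = (e + a) * (e + a).
    by rewrite mulrDl !mulrDr e_idem ea ae addrACA [a + _ * _]addrC.
  exact: norm_mul_le1.
rewrite -(@ler_pMn2r _ 4) // -normrMn.
have -> : (e + 3%:R / 2%:R *: a) *+ 4
   = ((e + a * a) + a *+ 2) *+ 3 + (e + - (a * a) *+ 3).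
  rewrite mulrnDl.
  have -> : (3%:R / 2%:R *: a) *+ 4 = a *+ 2 *+ 3.
    rewrite scalerMnl -mulrnA -[RHS]scaler_nat; congr (_ *: _).
    exact: three_halves_quadruple.
  move: (a *+ 2) (a * a) => t b.
  rewrite mulNrn [e + - _]addrC [(_ + t) *+ 3]mulrnDl [(e + b) *+ 3]mulrnDl.
  by rewrite [RHS]addrACA addrK [t *+ 3 + e]addrC addrA -mulrSr.
rewrite (le_trans (ler_normD _ _)) // [1 *+ 4]mulrSr lerD //.
by rewrite normrMn lerMn2r sq2.
Qed.

(** All multiples (3/2)^k a stay bounded, by iterating [norm_stretch]. This is
the extremality of e in the unit ball of its corner, for self-adjoint
directions. *)
Lemma norm_corner_eq0 a : star a = a -> e * a = a -> a * e = a ->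
  `|e + a| <= 1 -> `|e - a| <= 1 -> a = 0.
Proof.
move=> sa ea ae hp hm.
pose c : R[i] := 3%:R / 2%:R.
have cc : c^* = c by rewrite fmorph_div /= !conjC_nat.
have bnd k : `|e + c ^+ k *: a| <= 1 /\ `|e - c ^+ k *: a| <= 1.
  elim: k => [|k [hk hk']]; first by rewrite expr0 scale1r.
  have sk : star (c ^+ k *: a) = c ^+ k *: a by rewrite starZ sa rmorphXn /= cc.
  have ek : e * (c ^+ k *: a) = c ^+ k *: a by rewrite -scaleMr ea.
  have ke : (c ^+ k *: a) * e = c ^+ k *: a by rewrite -scaleMl ae.
  rewrite exprS -scalerA; split; first exact: norm_stretch.
  rewrite -scalerN; apply: norm_stretch; rewrite ?opprK //.
  - by rewrite starN sk.
  - by rewrite mulrN ek.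
  - by rewrite mulNr ke.
(* (3/2)^k grows without bound: 2 (3/2)^(k+1) = 3 (3/2)^k >= k + 1. *)
have bern k : k%:R <= c ^+ k *+ 2.
  elim: k => [|k IHk]; first by rewrite mulrn_wge0.
  rewrite exprS -mulrnAl -[c *+ 2]mulr_natr divfK ?pnatr_eq0 //.
  rewrite mulr_natl [_ *+ 3]mulrSr -natr1 lerD // exprn_ege1 //.
  by rewrite ler_pdivlMr ?ltr0n // mul1r ler_nat.
have bnd2 k : k%:R * `|a| <= 2%:R.
  apply: (@le_trans _ _ (`|c ^+ k *: a| *+ 2)).
    rewrite normrZ ger0_norm ?exprn_ge0 ?divr_ge0 ?ler0n //.
    by rewrite -mulrnAl ler_wpM2r.
  have [hp' hm'] := bnd k; rewrite ler_pMn2r //.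
  by apply: (@norm_mid _ e); [rewrite addrC | rewrite -normrN opprB].
(* The norm is a complex number; the Archimedean argument takes place in its
   real part. *)
have /RRe_real an : `|a| \is Num.real by exact: normr_real.
apply/eqP; rewrite -normr_eq0 -an; apply/eqP; congr _%:C%C.
set r := complex.Re _ in an *.
have bnd3 k : k%:R * r <= 2.
  have := bnd2 k; rewrite -an.
  rewrite -(rmorph_nat (real_complex R)) -rmorphM.
  by rewrite -(rmorph_nat (real_complex R) 2) lecR.
have r0 : 0 <= r.
  by have := normr_ge0 a; rewrite -an -(rmorph0 (real_complex R)) lecR.
apply/eqP; rewrite eq_le r0 andbT leNgt; apply/negP => rp.
have := truncnS_gt (2%:R / r); rewrite ltr_pdivrMr // ltNge.
by rewrite bnd3.
Qed.

(** With N summands, N e - c_k and N e + c_k are sums of N contractions: the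
former of e - c_k and copies of e, the latter of e and the e - c_i with i
different from k. So [norm_corner_eq0] applies to c_k / N. *)
Lemma corner_sum_eq0 (I : finType) (c : I -> X) :
    (forall i, star (c i) = c i) -> (forall i, e * c i = c i) ->
    (forall i, c i * e = c i) -> (forall i, `|e - c i| <= 1) ->
    \sum_i c i = 0 -> forall i, c i = 0.
Proof.
move=> cs ec ce cn c0 k; pose N := #|I|.
have N0 : (N%:R : R[i]) != 0.
  by rewrite pnatr_eq0 -lt0n; apply/card_gt0P; exists k.
have e1 : `|e| <= 1 by apply: projection_norm.
have sum_le (d : I -> X) : (forall i, `|d i| <= 1) -> `|\sum_i d i| <= N%:R.
  move=> hd; rewrite (le_trans (ler_norm_sum _ _ _)) //.
  by rewrite -(sumr_const I) ler_sum.
have eN : e *+ N = e + \sum_(i | i != k) e by rewrite -(sumr_const I) (bigD1 k).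
have scaled y : `|e *+ N + y| <= N%:R -> `|e + N%:R^-1 *: y| <= 1.
  have -> : e + N%:R^-1 *: y = N%:R^-1 *: (e *+ N + y).
    by rewrite scalerDr -(scaler_nat N e) scalerA mulVf // scale1r.
  by rewrite normrZ normfV normr_nat ler_pdivrMl ?mulr1 // lt0r N0 ler0n.
have plus : `|e *+ N + c k| <= N%:R.
  pose d i := if i == k then e else e - c i.
  have -> : e *+ N + c k = \sum_i d i.
    rewrite (bigD1 k) //= /d eqxx eN -addrA; congr (_ + _).
    have -> : c k = - \sum_(i | i != k) c i.
      apply/eqP; rewrite -addr_eq0; apply/eqP.
      by rewrite -[RHS]c0 [RHS](bigD1 k).
    by rewrite -sumrB; apply: eq_bigr => i /negbTE ->.
  by apply: sum_le => i; rewrite /d; case: eqP.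
have minus : `|e *+ N - c k| <= N%:R.
  pose d i := if i == k then e - c k else e.
  have -> : e *+ N - c k = \sum_i d i.
    rewrite (bigD1 k) //= /d eqxx eN addrAC; congr (_ + _).
    by apply: eq_bigr => i /negbTE ->.
  by apply: sum_le => i; rewrite /d; case: eqP.
have : N%:R^-1 *: c k = 0.
  apply: norm_corner_eq0.
  - by rewrite starZ cs fmorphV /= conjC_nat.
  - by rewrite -scaleMr ec.
  - by rewrite -scaleMl ce.
  - exact: scaled.
  - by rewrite -scalerN; apply: scaled.
by move/eqP; rewrite scaler_eq0 invr_eq0 (negbTE N0) => /eqP.
Qed.
End Corner.

(** In the corner of p_j, the compressions p_j p_i p_j with i different from j
sum to 0, and p_j - p_j p_i p_j = p_j (1 - p_i) p_j is a contraction. Hence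
they vanish, and p_j p_i p_j = (p_i p_j)^* (p_i p_j). *)
Lemma sum_projections_orthogonal (I : finType) (p : I -> X) :
    (forall i, star (p i) = p i) -> (forall i, p i * p i = p i) ->
    \sum_i p i = 1 -> forall i j, i != j -> p i * p j = 0.
Proof.
move=> ps pp p1 k j kj.
pose c i := if i == j then 0 else p j * p i * p j.
have ck : c k = 0.
  apply: (@corner_sum_eq0 (p j)) => // [i|i|i|i|]; rewrite /c.
  - by case: eqP; rewrite ?star0 // !starMr !ps mulrA.
  - by case: eqP; rewrite ?mulr0 // !mulrA pp.
  - by case: eqP; rewrite ?mul0r // -!mulrA pp.
  - case: eqP => _; first by rewrite subr0 projection_norm.
    have -> : p j - p j * p i * p j = p j * (1 - p i) * p j.
      by rewrite mulrBr mulrBl mulr1 pp.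
    apply: norm_mul_le1; last exact: projection_norm.
    apply: norm_mul_le1; first exact: projection_norm.
    apply: projection_norm; first by rewrite starD starN star1 ps.
    by rewrite mulrBr !mulrBl !mul1r !mulr1 pp subrr subr0.
  have : p j * (\sum_i p i) * p j = p j by rewrite p1 mulr1 pp.
  rewrite mulr_sumr mulr_suml (bigD1 j) //= !pp -[RHS]addr0.
  move=> /addrI h0; rewrite (bigD1 j) //= eqxx add0r -[RHS]h0.
  by apply: eq_bigr => i /negbTE ->.
apply: star_mul_eq0; rewrite starMr !ps mulrA -[_ * _ * p k]mulrA pp.
by move: ck; rewrite /c (negbTE kj).
Qed.
End CStarNorm.

(** * Words in a Cuntz-Krieger family *)

Section Words.
Variables (R : realType) (n : nat) (X : cstarAlgType R).
Implicit Types (l : 'I_n * bool) (v w : seq ('I_n * bool)) (mu nu : seq 'I_n).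

Section WordOp.
Variable s : 'I_n -> X.

Definition letter_op l : X := if l.2 then star (s l.1) else s l.1.
Definition word_op w : X := \prod_(l <- w) letter_op l.

Lemma letter_op_linv l : letter_op (linv l) = star (letter_op l).
Proof. by case: l => i []; rewrite /letter_op /= ?starK. Qed.

Lemma word_op_winv w : word_op (winv w) = star (word_op w).
Proof.
elim: w => [|l w IHw]; first by rewrite /word_op !big_nil star1.
rewrite /winv /= rev_cons /word_op -cats1 big_cat big_seq1 /=.
by rewrite -/(winv w) -/(word_op _) IHw letter_op_linv big_cons starMr.
Qed.
End WordOp.

Section CuntzKrieger.
Variables (D : 'M[nat]_n) (s : 'I_n -> X).
Hypothesis ck : cuntz_krieger_relations D s.
Let T := letter_op s.
Let W := word_op s.

Let sss i : star (s i) * s i * star (s i) = star (s i).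
Proof.
by apply: (can_inj (@starK _ _)); rewrite !starMr starK mulrA (ck_pisom ck).
Qed.

Lemma ck_orthogonal i k : i != k -> star (s i) * s k = 0.
Proof.
move=> ik.
have -> : star (s i) * s k
    = star (s i) * (s i * star (s i) * (s k * star (s k))) * s k.
  by rewrite -{1}(ck_pisom ck k) !mulrA sss.
suff -> : s i * star (s i) * (s k * star (s k)) = 0 by rewrite mulr0 mul0r.
apply: (sum_projections_orthogonal _ _ (ck_sum ck) ik) => j.
  by rewrite starMr starK.
by rewrite mulrA (ck_pisom ck).
Qed.

(** The source projection of s_i is a sum of range projections, and these are
mutually orthogonal. *)
Lemma ck_source_mul i k :
  star (s i) * s i * s k = if D i k == 1%N then s k else 0.
Proof.
rewrite (ck_init ck) // mulr_suml; case: ifP => dik.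
  rewrite (bigD1 k) //= (ck_pisom ck) // big1 ?addr0 // => j /andP[_ jk].
  by rewrite -mulrA ck_orthogonal ?mulr0.
rewrite big1 // => j dij; rewrite -mulrA ck_orthogonal ?mulr0 //.
by apply: contraFneq dik => <-.
Qed.

(** This is the projection S_mu S_mu^*. In the commutative picture it is the
indicator of the infinite paths that start with mu. *)
Definition cylinder mu : X := foldr (fun i x => s i * x * star (s i)) 1 mu.

Lemma cylinder_star mu : star (cylinder mu) = cylinder mu.
Proof.
by elim: mu => [|i mu IH] /=; rewrite ?star1 // !starMr starK IH mulrA.
Qed.

Lemma source_cylinder i mu : mu != [::] ->
  star (s i) * s i * cylinder mu = cylinder mu \/
  star (s i) * s i * cylinder mu = 0.
Proof.
case: mu => // k mu _ /=; rewrite !mulrA ck_source_mul.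
by case: ifP => _; [left | right; rewrite !mul0r].
Qed.

Lemma source_cylinder_comm i mu : GRing.comm (star (s i) * s i) (cylinder mu).
Proof.
have [->|mu0] := eqVneq mu [::]; first exact: commr1.
have qs : star (star (s i) * s i) = star (s i) * s i by rewrite starMr starK.
apply: (can_inj (@starK _ _)); rewrite [RHS]starMr qs cylinder_star.
by case: (source_cylinder i mu0) => ->; rewrite ?star0 ?cylinder_star.
Qed.

(** Two cylinders are disjoint unless one of the words is a prefix of the
other: unequal first letters give products 0 in both orders, and equal first
letters can be stripped. *)
Lemma cylinder_comm mu nu : GRing.comm (cylinder mu) (cylinder nu).
Proof.
elim: mu nu => [|i mu IH] nu; first exact/commr_sym/commr1.
case: nu => [|k nu]; first exact: commr1.
have [<-|ik] := eqVneq i k.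
  have h a b : s i * cylinder a * star (s i) * (s i * cylinder b * star (s i))
             = s i * (cylinder a * cylinder b) * star (s i).
    have -> : s i * cylinder a * star (s i) * (s i * cylinder b * star (s i))
        = s i * (cylinder a * (star (s i) * s i)) * cylinder b * star (s i).
      by rewrite !mulrA.
    by rewrite -source_cylinder_comm !mulrA (ck_pisom ck).
  by rewrite /GRing.comm /= !h (IH nu).
have h a b x y : a != b ->
    s a * cylinder x * star (s a) * (s b * cylinder y * star (s b)) = 0.
  move=> ab; rewrite -!mulrA [star (s a) * _]mulrA ck_orthogonal //.
  by rewrite mul0r !mulr0.
by rewrite /GRing.comm /= !h // eq_sym.
Qed.

(** Finite sums of cylinders suffice for the range projections of all words:
unlike the set of cylinders, they are stable under conjugation by the inverse
letters, because a source projection is a sum of cylinders. *)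
Inductive diagonal : X -> Prop :=
| diagonal0 : diagonal 0
| diagonal_add_cylinder mu x : diagonal x -> diagonal (cylinder mu + x).

Lemma diagonal_cylinder mu : diagonal (cylinder mu).
Proof. by rewrite -[cylinder mu]addr0; do 2!constructor. Qed.

Lemma diagonalD x y : diagonal x -> diagonal y -> diagonal (x + y).
Proof.
move=> dx dy; elim: dx => [|mu z _ IH]; rewrite ?add0r // -addrA.
by constructor.
Qed.

Lemma diagonal_comm x y : diagonal x -> diagonal y -> GRing.comm x y.
Proof.
move=> + dy; elim=> [|mu {}x _ IHx]; first exact/commr_sym/commr0.
apply: commr_sym; apply: commrD; last exact: commr_sym.
apply: commr_sym; elim: dy => [|nu z _ IHz]; first exact: commr0.
by apply: commrD => //; apply: cylinder_comm.
Qed.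

(** Conjugation by s_i^* removes a leading letter i. What remains is multiplied
by the source projection of s_i, which keeps or kills a nonempty cylinder; for
the empty word that projection itself remains. *)
Lemma diagonal_source_cylinder i mu :
  diagonal (star (s i) * cylinder mu * s i).
Proof.
have dq : diagonal (star (s i) * s i).
  rewrite (ck_init ck) //; apply: (big_ind diagonal) => [||j _].
  - exact: diagonal0.
  - exact: diagonalD.
  - by have := diagonal_cylinder [:: j]; rewrite /= mulr1.
case: mu => [|k mu] /=; first by rewrite mulr1.
have [<-|ik] := eqVneq i k; last first.
  by rewrite !mulrA ck_orthogonal // !mul0r; apply: diagonal0.
have -> : star (s i) * (s i * cylinder mu * star (s i)) * s i
          = star (s i) * s i * cylinder mu.
  transitivity (star (s i) * s i * (cylinder mu * (star (s i) * s i))).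
    by rewrite !mulrA.
  by rewrite -source_cylinder_comm !mulrA sss.
have [->|mu0] := eqVneq mu [::]; first by rewrite mulr1.
case: (source_cylinder i mu0) => ->; last exact: diagonal0.
exact: diagonal_cylinder.
Qed.

Lemma diagonal_letter l x : diagonal x -> diagonal (T l * x * star (T l)).
Proof.
elim=> [|mu {}x _ IHx]; first by rewrite mulr0 mul0r; apply: diagonal0.
rewrite mulrDr mulrDl; apply: diagonalD => //.
case: l {IHx} => i []; rewrite /T /letter_op /= ?starK.
  exact: diagonal_source_cylinder.
exact: (diagonal_cylinder (i :: mu)).
Qed.

Lemma diagonal_word w : diagonal (W w * star (W w)).
Proof.
elim: w => [|l w IHw]; rewrite /W /word_op.
  by rewrite big_nil star1 mulr1; apply: (diagonal_cylinder [::]).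
rewrite big_cons starMr -!mulrA [X in _ * X]mulrA mulrA.
exact: diagonal_letter.
Qed.

Lemma letter_pisom l : T l * star (T l) * T l = T l.
Proof.
by case: l => i []; rewrite /T /letter_op /= ?starK ?sss // (ck_pisom ck).
Qed.

(** Products of letters are multiplicative up to the range projection of the
first factor: if l cancels the head of w, both sides are literally
T_l T_l^* followed by the rest of w. *)
Lemma letter_word l w : T l * W w = T l * star (T l) * W (push l w).
Proof.
have E : T l * W w = T l * star (T l) * W (l :: w).
  by rewrite {2}/W /word_op big_cons mulrA letter_pisom.
case: w E => // k w E /=; case: eqP => // -> in E *.
by rewrite {1}/W /word_op big_cons letter_op_linv mulrA.
Qed.

(** This is the multiplication rule of a partial representation, in adjoint
form, where it can be proved by induction on the left factor w: peeling off a
letter l moves l^-1 into v by [letter_word], at the price of a factor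
T_l^* T_l, which commutes with the remaining range projection and is absorbed
by T_l. *)
Lemma range_mul_word w v : W w * star (W w) * W v = W w * W (wmul (winv w) v).
Proof.
elim: w v => [|l w IHw] v.
  by rewrite /W /word_op big_nil star1 mulr1.
have -> : wmul (winv (l :: w)) v = wmul (winv w) (push (linv l) v).
  by rewrite /winv /= rev_cons /wmul foldr_rcons.
rewrite {1 2 4}/W /word_op !big_cons -/(word_op s w) -/W -/(T l) starMr.
rewrite -[RHS]mulrA -IHw -!mulrA.
have := letter_word (linv l) v; rewrite /T letter_op_linv starK -/T => ->.
have cE : GRing.comm (W w * star (W w)) (star (T l) * T l).
  apply: diagonal_comm; first exact: diagonal_word.
  have := diagonal_word [:: linv l].
  by rewrite /W /word_op big_seq1 letter_op_linv starK.
rewrite [W w * (star (W w) * (_ * _))]mulrA [W w * star (W w) * _]mulrA cE.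
by rewrite !mulrA letter_pisom.
Qed.
End CuntzKrieger.
End Words.

(** * The two presentations determine each other *)

(** Each cancellation shortens the product. *)
Lemma wmul_cat n (v w : seq ('I_n * bool)) :
  size (wmul v w) = (size v + size w)%N -> wmul v w = v ++ w.
Proof.
have size_push l (x : seq ('I_n * bool)) : (size (push l x) <= (size x).+1)%N.
  by case: x => //= k x; case: eqP => //= _; rewrite ltnW.
have size_wmul (x : seq ('I_n * bool)) : (size (wmul x w) <= size x + size w)%N.
  by elim: x => //= l x IHx; rewrite (leq_trans (size_push _ _)).
elim: v => //= l v IHv.
have pushE (x : seq ('I_n * bool)) :
    size (push l x) = (size x).+1 -> push l x = l :: x.
  by case: x => //= k x; case: eqP => //= _ /eqP; rewrite ltn_eqF // leqW.
move=> h; have hs : size (wmul v w) = (size v + size w)%N.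
  by apply/eqP; rewrite eqn_leq size_wmul -ltnS -addSn -h size_push.
by rewrite (pushE _ (etrans h (esym (congr1 S hs)))) (IHv hs).
Qed.

Section Oab.
Variables (R : realType) (n : nat).

(** The generator i acts as S_{sg i}. All range projections and their
conjugates that occur in the relations are range projections of (possibly
unreduced) words, so that commutation follows from [diagonal_comm]; the
multiplication rule and saturation are instances of [range_mul_word]. *)
Lemma ck_oab (A : 'M[nat]_n) (sg : 'S_n) (D : 'M[nat]_n) (X : cstarAlgType R)
    (S : 'I_n -> X) :
    zero_one A -> (forall i k, D (sg i) k = A i k) ->
    cuntz_krieger_relations D S ->
  oab_relations A (perm_mx sg) (fun r => word_op (S \o sg) (val r))
    (fun j => S j * star (S j)).
Proof.
move=> hA hD ck; set s := S \o sg; set W := word_op s.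
(* Relabelled along sg, the family is again a Cuntz-Krieger family. *)
have cks : cuntz_krieger_relations (\matrix_(i, k) D (sg i) (sg k)) s.
  split=> [i||i]; first exact: (ck_pisom ck).
    by rewrite -[RHS](ck_sum ck) [RHS](reindex_inj (@perm_inj _ sg)).
  rewrite (ck_init ck) [LHS](reindex_inj (@perm_inj _ sg)).
  by apply: eq_bigl => k; rewrite mxE.
have WP j : S j * star (S j)
    = W [:: ((sg^-1)%g j, false)] * star (W [:: ((sg^-1)%g j, false)]).
  by rewrite /W /word_op big_seq1 /letter_op /s /= permKV.
have WC v w : W v * W w = W (v ++ w) by rewrite /W /word_op big_cat.
have conjW r j :
    exists w, W r * (S j * star (S j)) * star (W r) = W w * star (W w).
  exists (r ++ [:: ((sg^-1)%g j, false)]).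
  by rewrite -WC WP starMr !mulrA.
split=> [|r|r t|j|j|r t j|r t i j||i|i|r t] /=.
- by rewrite /W /word_op big_nil.
- exact: word_op_winv.
- (* [range_mul_word] is the adjoint of this relation. *)
  apply: (can_inj (@starK _ _)).
  rewrite -/W !starMr -!word_op_winv -/W winvK.
  have -> : winv (wmul (val r) (val t)) = wmul (winv (val t)) (winv (val r)).
    by have := congr1 val (invMg r t).
  by rewrite -(range_mul_word cks) -/W -word_op_winv -mulrA.
- by rewrite starMr starK.
- by rewrite mulrA (ck_pisom ck).
- have [w ->] := conjW (val t) j.
  by apply: (diagonal_comm cks); apply: (diagonal_word cks).
- have [v ->] := conjW (val r) i; have [w ->] := conjW (val t) j.
  by apply: (diagonal_comm cks); apply: (diagonal_word cks).
- exact: (ck_sum ck).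
- rewrite /W /word_op big_seq1 /letter_op /= (ck_init ck) big_mkcond.
  by apply: eq_bigr => j _; rewrite hD; case: (hA i j) => ->.
- rewrite /W /word_op big_seq1 /letter_op /= (bigD1 (sg i)) //= big1 => [|j ji].
    by rewrite !mxE eqxx addr0.
  by rewrite !mxE eq_sym (negbTE ji).
- rewrite /fg_length /= => /wmul_cat rtE.
  rewrite mulrA [X in X * _ = _](range_mul_word cks) -/W; congr (_ * _).
  have -> : wmul (winv (val r)) (wmul (val r) (val t)) = val t.
    by have := congr1 val (mulKg r t).
  by rewrite rtE WC.
Qed.

Section OabWords.
Variables (A B : 'M[nat]_n) (X : cstarAlgType R).
Variables (u : free_group n -> X) (P : 'I_n -> X).
Hypothesis oab : oab_relations A B u P.

Lemma oab_pisom r : u r * star (u r) * u r = u r.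
Proof.
have := oab_mul oab r r^-1%g.
by rewrite invgK mulgV (oab_one oab) mul1r (oab_inv oab).
Qed.

(** Saturation gives [r][r]^*[rt] = [rt], while the adjoint of the partial
multiplication rule gives [r][r]^*[rt] = [r][t]. *)
Lemma oab_mul_reduced r t :
  fg_length (r * t)%g = (fg_length r + fg_length t)%N ->
  u (r * t)%g = u r * u t.
Proof.
move=> hrt.
have -> : u (r * t)%g = u r * star (u r) * u (r * t)%g.
  by rewrite -{1 2}oab_pisom !mulrA -[u r * _ * _ * _]mulrA (oab_saturated oab).
have := oab_mul oab (r * t)^-1%g r.
rewrite invMg mulgKV => /(congr1 star).
by rewrite !starMr -!(oab_inv oab) !invMg !invgK mulrA.
Qed.

Lemma oab_word r : u r = word_op (u \o @fg_gen n) (val r).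
Proof.
case: r => w; elim: w => [|l w IHw] red /=.
  rewrite /word_op big_nil -(oab_one oab); congr u; exact: val_inj.
have rw : reduced w by exact: path_sorted red.
pose r : free_group n := exist _ w rw.
pose g : free_group n := exist _ [:: l] isT.
have E : exist _ (l :: w) red = (g * r)%g :> free_group n.
  by apply: val_inj; rewrite /= push_cons.
rewrite E oab_mul_reduced -?E // /word_op big_cons.
congr (_ * _); last exact: IHw.
rewrite /letter_op /g; case: l {red g E} => i [] /=.
  by rewrite -(oab_inv oab); congr u; exact: val_inj.
by congr u; exact: val_inj.
Qed.
End OabWords.

Lemma star_hom_word (X Y : cstarAlgType R) (f : X -> Y) (s : 'I_n -> X) w :
  star_hom f -> f (word_op s w) = word_op (f \o s) w.
Proof.
move=> hf; rewrite /word_op (big_morph f (star_homM hf) (star_hom1 hf)).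
apply: eq_bigr => -[i []] _ //; exact: star_homS.
Qed.

(** A homomorphism matching the Cuntz-Krieger generators matches all the
generators of O_{A,B}, as both [r] and P_j are words in them; so existence and
uniqueness carry over from one universal property to the other. *)
Lemma oab_cuntz_krieger (A : 'M[nat]_n) (sg : 'S_n) (O : cstarAlgType R) :
  zero_one A -> is_oab A (perm_mx sg) O ->
  is_cuntz_krieger ((perm_mx sg)^T *m A) O.
Proof.
move=> hA [g [rg ug]]; set D := _ *m A.
have DE i k : D (sg i) k = A i k.
  rewrite mxE (bigD1 i) //= !mxE eqxx mul1r big1 ?addr0 // => j ji.
  by rewrite !mxE (inj_eq perm_inj) (negbTE ji) mul0r.
have hD : zero_one D by move=> i k; rewrite -(permKV sg i) DE.
split=> //.
pose S j := g (inl (fg_gen ((sg^-1)%g j))).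
have SP j : S j * star (S j) = g (inr j).
  rewrite (oab_final rg) (bigD1 j) //= big1 => [|k kj].
    by rewrite !mxE permKV eqxx addr0.
  by rewrite !mxE permKV eq_sym (negbTE kj).
have ckS : cuntz_krieger_relations D S.
  split=> [j||j]; first exact: (oab_pisom rg).
    by rewrite -[RHS](oab_sum rg); apply: eq_bigr => j _; rewrite SP.
  rewrite (oab_init rg) [RHS]big_mkcond; apply: eq_bigr => k _.
  by rewrite SP -DE permKV; case: (hD j k) => ->.
exists S; split=> // Y h ckh.
have rh := ck_oab hA DE ckh.
pose h' (x : free_group n + 'I_n) := match x with
  | inl r => word_op (h \o sg) (val r) | inr j => h j * star (h j) end.
have [f [[hf fE] fU]] := ug Y h' rh.
exists f; split=> [|f' [hf' f'E]].
  split=> // j; rewrite /S fE /h' /word_op big_seq1 /letter_op /=.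
  by rewrite permKV.
apply: fU; split=> // -[r|j] /=.
  rewrite (oab_word rg) star_hom_word //; congr word_op.
  by apply/funext => i /=; rewrite -f'E /S permK.
by rewrite -SP (star_homM hf') (star_homS hf') f'E.
Qed.

(** * Exchanging A and B *)

(** This is the automorphism of the free group that inverts every generator; it
acts on the letters of a word without reversing their order. *)
Definition flip (r : free_group n) : free_group n.
Proof.
exists (map (@linv n) (val r)).
rewrite /reduced sorted_map; apply: sub_sorted (valP r) => k l /=.
by rewrite (inj_eq (inv_inj (@linvK n))).
Defined.

Lemma flipK : involutive flip.
Proof. by move=> r; apply: val_inj; rewrite /= mapK //; apply: linvK. Qed.

Lemma flipM r t : flip (r * t)%g = (flip r * flip t)%g.
Proof.
apply: val_inj => /=; elim: (val r) => //= l w <-.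
case: (wmul w (val t)) => //= k x.
by rewrite (inj_eq (inv_inj (@linvK n))); case: eqP.
Qed.

Lemma flip1 : flip 1%g = 1%g. Proof. exact: val_inj. Qed.

Lemma flipV r : flip r^-1%g = (flip r)^-1%g.
Proof. by apply: (mulgI (flip r)); rewrite -flipM !mulgV flip1. Qed.

Lemma flip_gen i : flip (fg_gen i) = (fg_gen i)^-1%g.
Proof. exact: val_inj. Qed.

Lemma flip_length r : fg_length (flip r) = fg_length r.
Proof. exact: size_map. Qed.

Lemma oab_relations_flip (A B : 'M[nat]_n) (X : cstarAlgType R)
    (u : free_group n -> X) (P : 'I_n -> X) :
  oab_relations A B u P -> oab_relations B A (u \o flip) P.
Proof.
case=> h1 hV hM Pa Pi uP PP sP hA hB hS.
split=> //= [|r|r t|i|i|r t rt].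
- by rewrite flip1.
- by rewrite flipV.
- by rewrite flipV flipM.
- by rewrite flip_gen hV starK.
- by rewrite flip_gen hV starK.
- by rewrite flipM hS // -flipM !flip_length.
Qed.

Lemma is_oab_flip (A B : 'M[nat]_n) (O : cstarAlgType R) :
  is_oab A B O -> is_oab B A O.
Proof.
pose fl (x : free_group n + 'I_n) :=
  match x with inl r => inl (flip r) | inr j => inr j end.
have flK : involutive fl by case=> // r /=; rewrite flipK.
move=> [g [rg ug]]; exists (g \o fl).
split; first exact: (oab_relations_flip rg).
move=> Y h rh.
have [f [[hf fE] fU]] := ug Y (h \o fl) (oab_relations_flip rh).
exists f; split=> [|f' [hf' f'E]]; first by split=> // x; rewrite /= fE /= flK.
by apply: fU; split=> // x; rewrite /= -f'E /= flK.
Qed.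
End Oab.

Theorem proposition5p1 (R : realType) (n : nat) (A B : 'M[nat]_n)
    (hA : zero_one A) (hB : zero_one B)
    (O : cstarAlgType R) (hO : is_oab A B O) :
  (is_perm_mx A \/ is_perm_mx B ->
     exists (m : nat) (D : 'M[nat]_m) (X : cstarAlgType R),
       is_cuntz_krieger D X /\ star_isomorphic O X) /\
  (is_perm_mx B ->
     (exists X : cstarAlgType R, is_cuntz_krieger (B^T *m A) X) /\
     (forall X : cstarAlgType R,
        is_cuntz_krieger (B^T *m A) X -> star_isomorphic O X)).
Proof.
have iso_refl (X : cstarAlgType R) : star_isomorphic X X.
  by exists id; split; [apply: star_hom_id | exists id].
have main (A' B' : 'M[nat]_n) : zero_one A' -> is_oab A' B' O ->
    is_perm_mx B' -> is_cuntz_krieger (B'^T *m A') O.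
  move=> zA hO' /is_perm_mxP[sg BE]; move: hO'; rewrite BE.
  exact: oab_cuntz_krieger.
split=> [[pA|pB]|pB].
- exists n, (A^T *m B), O; split=> //; apply: main => //; exact: is_oab_flip.
- by exists n, (B^T *m A), O; split=> //; apply: main.
- have ckO := main _ _ hA hO pB; split=> [|X [_ [S uS]]]; first by exists O.
  by have [_ [T uT]] := ckO; apply: universal_cstar_iso uT uS.
Qed.
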